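(* Let $k$ be a positive integer and let $d\in\mathcal{U}(\mathcal{D}_2^k)$ be such that $\lambda_d$ is extendible. Then $\lambda_d$ is the product of a gauge automorphism and an inner localized automorphism.
   Context: $\mathcal{Q}_2$ (the 2-adic ring $C^*$-algebra) is the universal unital $C^*$-algebra generated by an isometry $S_2$ and a unitary $U$ such that $S_2S_2^*+US_2S_2^*U^*=1$ and $S_2U=U^2S_2$. Put $S_1=US_2$. The $C^*$-subalgebra generated by $S_1,S_2$ is a copy of the Cuntz algebra $\mathcal{O}_2$, and $\mathcal{O}_2\subset\mathcal{Q}_2$ always refers to this copy. For a multi-index $\alpha=(\alpha_1,\ldots,\alpha_k)\in\{1,2\}^k$ let $|\alpha|=k$, $S_\alpha=S_{\alpha_1}\cdots S_{\alpha_k}$ and $P_\alpha=S_\alpha S_\alpha^*$. Let $\mathcal{D}_2^k=\mathrm{span}\{P_\alpha:|\alpha|=k\}$, and let $\mathcal{D}_2$ be the (commutative) $C^*$-algebra generated by all $P_\alpha$; $\mathcal{U}(\cdot)$ denotes the unitary group. For a unitary $u\in\mathcal{O}_2$, $\lambda_u$ is the unital endomorphism of $\mathcal{O}_2$ with $\lambda_u(S_i)=uS_i$, $i=1,2$; when $u\in\mathcal{U}(\mathcal{D}_2)$ it is an automorphism fixing $\mathcal{D}_2$ pointwise. For $d\in\mathcal{U}(\mathcal{D}_2)$, $\lambda_d$ (or $d$) is called extendible if $\lambda_d$ extends to an automorphism of $\mathcal{Q}_2$. Gauge automorphisms of $\mathcal{O}_2$ are $\alpha_\theta$, $\theta\in\mathbb{R}$,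 with $\alpha_\theta(S_i)=e^{i\theta}S_i$. An automorphism $\lambda_u$ of $\mathcal{O}_2$ is localized if $u\in\bigcup_k\mathcal{F}_2^k$, where $\mathcal{F}_2^k=\mathrm{span}\{S_\alpha S_\beta^*:|\alpha|=|\beta|=k\}$. *)

(* Defs.v *)
From HB Require Import structures.
From mathcomp Require Import all_boot all_order all_algebra.
From mathcomp Require Import complex.
From mathcomp Require Import all_classical all_reals all_analysis.

Set Implicit Arguments.
Unset Strict Implicit.
Unset Printing Implicit Defensive.

Import Order.TTheory GRing.Theory Num.Theory.
Import numFieldNormedType.Exports.

Local Open Scope classical_set_scope.
Local Open Scope ring_scope.

(* Unital C*-algebras over R[i].  The algebra is an algType (so 1 != 0), and the
   real-valued norm is a field of the mixin: algType cannot be joined with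
   completeNormedModType, because numDomainType already inherits from ring and
   normed Z-module structures without a common join. *)
HB.mixin Record isCStarAlgebra (R : realType) A of GRing.Algebra R[i] A := {
  cnorm : A -> R ;
  star : A -> A ;
  ler_cnormD : forall x y : A, cnorm (x + y) <= cnorm x + cnorm y ;
  cnormZ : forall (a : R[i]) (x : A), cnorm (a *: x) = Normc.normc a * cnorm x ;
  cnorm0_eq0 : forall x : A, cnorm x = 0 -> x = 0 ;
  ler_cnormM : forall x y : A, cnorm (x * y) <= cnorm x * cnorm y ;
  cnorm_complete : forall x_ : nat -> A,
    (forall e : R, 0 < e -> exists N : nat, forall m n : nat,
       (N <= m)%N -> (N <= n)%N -> cnorm (x_ m - x_ n) < e) ->
    exists l : A, cnorm (x_ n - l) @[n --> \oo] --> (0 : R) ;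
  starD : forall x y : A, star (x + y) = star x + star y ;
  starZ : forall (a : R[i]) (x : A), star (a *: x) = (a^*)%C *: star x ;
  starM : forall x y : A, star (x * y) = star y * star x ;
  starK : forall x : A, star (star x) = x ;
  cstar_identity : forall x : A, cnorm (star x * x) = cnorm x ^+ 2 }.

#[short(type="cstarAlgType")]
HB.structure Definition CStarAlgebra (R : realType) :=
  {A of isCStarAlgebra R A & GRing.Algebra R[i] A}.

Section CStar.
Variable R : realType.
Implicit Types A B : cstarAlgType R.

Definition norm_closed A (X : set A) : Prop :=
  forall (x_ : nat -> A) (l : A), (forall n, X (x_ n)) ->
    cnorm (x_ n - l) @[n --> \oo] --> (0 : R) -> X l.

Definition unitary A (u : A) : Prop := star u * u = 1 /\ u * star u = 1.

Record cstar_subalgebra A (X : set A) : Prop := CStarSubalgebra {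
  csub0 : X 0 ;
  csubD : forall x y, X x -> X y -> X (x + y) ;
  csubZ : forall (a : R[i]) x, X x -> X (a *: x) ;
  csubM : forall x y, X x -> X y -> X (x * y) ;
  csub_star : forall x, X x -> X (star x) ;
  csub_closed : norm_closed X }.

Definition cstar_generated A (G : set A) : set A :=
  \bigcap_(X in [set X | cstar_subalgebra X /\ G `<=` X]) X.

(* Maps out of a subalgebra X of A are represented by functions on A of which
   only the restriction to X matters. *)
Record unital_star_hom A B (X : set A) (f : A -> B) : Prop := UnitalStarHom {
  shom1 : f 1 = 1 ;
  shomD : forall x y, X x -> X y -> f (x + y) = f x + f y ;
  shomZ : forall (a : R[i]) x, X x -> f (a *: x) = a *: f x ;
  shomM : forall x y, X x -> X y -> f (x * y) = f x * f y ;
  shom_star : forall x, X x -> f (star x) = star (f x) }.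

Definition star_endo A (X : set A) (f : A -> A) : Prop :=
  unital_star_hom X f /\ set_fun X X f.

Definition star_auto A (X : set A) (f : A -> A) : Prop :=
  unital_star_hom X f /\ set_bij X X f.

Definition family_span A (I : finType) (v : I -> A) : set A :=
  [set x | exists c : I -> R[i], x = \sum_i c i *: v i].

Definition Q2_relations A (S2 U : A) : Prop :=
  [/\ star S2 * S2 = 1, unitary U,
      S2 * star S2 + U * S2 * star S2 * star U = 1 & S2 * U = U ^+ 2 * S2].

(* A is the universal unital C*-algebra generated by S2 and U subject to the
   relations (uniqueness of the map follows from generation). *)
Definition is_Q2 A (S2 U : A) : Prop :=
  [/\ Q2_relations S2 U,
      cstar_generated [set S2; U] = setT
    & forall B (s u : B), Q2_relations s u ->
        exists f : A -> B, [/\ unital_star_hom setT f, f S2 = s & f U = u] ].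

Section Q2.
Variables (A : cstarAlgType R) (S2 U : A).

(* The alphabet {1, 2} is 'I_2: the index 0 stands for 1, the index 1 for 2. *)
Definition gen (i : 'I_2) : A := if i == ord0 then U * S2 else S2.

Definition monomial k (alpha : k.-tuple 'I_2) : A :=
  \prod_(i <- alpha) gen i.

Definition proj k (alpha : k.-tuple 'I_2) : A :=
  monomial alpha * star (monomial alpha).

Definition O2 : set A := cstar_generated (range gen).

Definition D2_level k : set A := family_span (@proj k).

Definition F2_level k : set A :=
  family_span (fun ab : k.-tuple 'I_2 * k.-tuple 'I_2 =>
    monomial ab.1 * star (monomial ab.2)).

(* f represents lambda_u on O2; by generation and continuity this determines
   f on O2. *)
Definition is_lambda (u : A) (f : A -> A) : Prop :=
  star_endo O2 f /\ forall i, f (gen i) = u * gen i.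

Definition extends_to_automorphism (f : A -> A) : Prop :=
  exists Phi : A -> A, star_auto setT Phi /\ forall x, O2 x -> Phi x = f x.

Definition gauge_automorphism (theta : R) (f : A -> A) : Prop :=
  star_auto O2 f /\ forall i, f (gen i) = (cos theta +i* sin theta)%C *: gen i.

Definition inner_automorphism (f : A -> A) : Prop :=
  exists w, [/\ O2 w, unitary w & forall x, O2 x -> f x = w * x * star w].

Definition localized_automorphism (f : A -> A) : Prop :=
  star_auto O2 f /\
  exists u, [/\ unitary u, exists k, F2_level k u & is_lambda u f].

End Q2.
End CStar.

(* Main.v *)
(* In the canonical representation on l^2(Z), S_2 e_j = e_(2j) and U e_j = e_(j+1);
   the spectrum of D_2 is the ring of 2-adic integers, d is a function c(n) of n mod
   2^k, and putting S_1 or S_2 in front of a point n gives 2n+1 or 2n.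

   If Phi extends lambda_d and W = Phi(U), the relations for Phi(S_2) = d S_2 and W
   force W U^* to act near 2^m j, j odd, as the scalar
     prod_(i <= m) c(2^i j) / c(2^i j - 1).
   On the other hand A is the closed span of the words U^a S_2^p S_2^*^q U^b, and the
   compression of such a word to a small ball around 2^m j is, for m large, a scalar
   that depends neither on m nor on j.  Hence c(-1) = c(0), and the product above has
   the same value C for all odd j when m >= k.

   Livsic's construction gives w0(n) = prod_(1 <= i <= k) c(0) / c(2^i n), which solves
   c(n) = c(0) w0(n) / w0(floor(n/2)) for even n; the analogous w1, built with the digit
   1 in front, solves it for odd n.  The previous paragraph says that r = w1/w0 satisfies
   r(2y) r(2y+1) = C r(y), which for a periodic r forces r = C, so that w0 solves the
   equation for all n.  With w the unitary of D_2 given by w0, this is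
   d S_i w = c(0) w S_i: lambda_d is the gauge automorphism of c(0) times Ad w. *)
Require Import Defs.
From HB Require Import structures.
From mathcomp Require Import all_boot all_order all_algebra.
From mathcomp Require Import ring lra zify.
From mathcomp Require Import complex.
From mathcomp Require Import all_classical all_reals all_analysis.

Set Implicit Arguments.
Unset Strict Implicit.
Unset Printing Implicit Defensive.

Import Order.TTheory GRing.Theory Num.Theory.
Import numFieldNormedType.Exports.

Local Open Scope classical_set_scope.
Local Open Scope ring_scope.

(** * Norm and involution in a C*-algebra; a square root by iteration *)

Section CStarAlgebra.
Variables (R : realType) (A : cstarAlgType R).
Implicit Types x y : A.

Lemma star1 : star 1 = 1 :> A.
Proof. by have := congr1 star (mulr1 (star (1 : A))); rewrite starM starK mulr1. Qed.

Lemma star0 : star 0 = 0 :> A.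
Proof. by apply: (addrI (star 0)); rewrite -starD !addr0. Qed.

Lemma starN x : star (- x) = - star x.
Proof. by apply/eqP; rewrite -addr_eq0 -starD addNr star0. Qed.

Lemma starB x y : star (x - y) = star x - star y.
Proof. by rewrite starD starN. Qed.

Lemma starX x n : star (x ^+ n) = star x ^+ n.
Proof. by elim: n => [|n IH]; rewrite ?expr0 ?star1 // exprS exprSr starM IH. Qed.

Lemma cnorm0 : cnorm (0 : A) = 0.
Proof. by rewrite -(scale0r (0 : A)) cnormZ Normc.normc0 mul0r. Qed.

Lemma cnormN x : cnorm (- x) = cnorm x.
Proof. by rewrite -scaleN1r cnormZ normcN Normc.normc1 mul1r. Qed.

Lemma cnorm_ge0 x : 0 <= cnorm x.
Proof.
by have := ler_cnormD x (- x); rewrite subrr cnorm0 cnormN; lra.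
Qed.

Lemma cnormB x y : cnorm (x - y) = cnorm (y - x).
Proof. by rewrite -cnormN opprB. Qed.

Lemma cnorm_star x : cnorm (star x) = cnorm x.
Proof.
suff H y : cnorm y <= cnorm (star y).
  by apply/eqP; rewrite eq_le H andbT -{2}(starK x) H.
have [->|y0] := eqVneq (cnorm y) 0; first exact: cnorm_ge0.
have y_gt0 : 0 < cnorm y by rewrite lt_def y0 cnorm_ge0.
by rewrite -(ler_pM2r y_gt0) -expr2 -cstar_identity ler_cnormM.
Qed.

Lemma cnorm1 : cnorm (1 : A) = 1.
Proof.
have n0 : cnorm (1 : A) != 0 by apply/eqP => /cnorm0_eq0/eqP; rewrite oner_eq0.
by apply: (mulfI n0); rewrite mulr1 -expr2 -cstar_identity star1 mul1r.
Qed.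

Lemma cnorm_isometry x : star x * x = 1 -> cnorm x = 1.
Proof.
move=> x1; have := cstar_identity x; rewrite x1 cnorm1 => /esym/eqP.
by rewrite sqrp_eq1 ?cnorm_ge0// => /eqP.
Qed.

Lemma mul_star_eq0 x : x * star x = 0 -> x = 0.
Proof.
move=> x0; apply: cnorm0_eq0; have := cstar_identity (star x).
by rewrite starK x0 cnorm0 cnorm_star => /esym/eqP; rewrite sqrf_eq0 => /eqP.
Qed.

Lemma cnorm_cvgP (x_ : nat -> A) (l : A) :
  cnorm (x_ n - l) @[n --> \oo] --> (0 : R) <->
  forall e, 0 < e -> exists N, forall n, (N <= n)%N -> cnorm (x_ n - l) < e.
Proof.
split=> [/cvgr0Pnorm_lt H e e0|H].
  have [N _ HN] := H e e0; exists N => n Nn.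
  by have := HN n Nn; rewrite /= ger0_norm ?cnorm_ge0.
apply/cvgr0Pnorm_lt => e e0; have [N HN] := H e e0.
by exists N => // n /= Nn; rewrite ger0_norm ?cnorm_ge0 ?HN.
Qed.

(** Later limit arguments end with an error that is a fixed multiple of [e]. As [K] may have any
    sign, the proof tests at [e] divided by [|K| + 1]. *)
Lemma cnorm_le_eps x (K : R) :
  (forall e, 0 < e -> cnorm x <= K * e) -> x = 0.
Proof.
move=> H; apply: cnorm0_eq0; apply/eqP; rewrite eq_le cnorm_ge0 andbT.
apply/ler_addgt0Pl => e e0; rewrite addr0.
have K0 : 0 < `|K| + 1 by rewrite ltr_wpDl.
apply: (le_trans (H (e / (`|K| + 1)) _)); first exact: divr_gt0.
rewrite mulrCA ger_pMr// ler_pdivrMr// mul1r.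
by apply: (le_trans (ler_norm K)); rewrite lerDl.
Qed.

(* Solves [2 z = h^2 + z^2] by iteration and takes [y = 1 - z]. *)
Lemma sqrt_one_sub_sqr (h : A) : star h = h -> cnorm h <= 2^-1 ->
  exists y, [/\ star y = y, y * h = h * y & y * y = 1 - h * h].
Proof.
move=> hs hle.
pose F z : A := (2^-1 : R[i]) *: (h * h + z * z).
have n2 : Normc.normc (2^-1 : R[i]) = 2^-1 by rewrite Normc.normcV (normcMn 1) Normc.normc1.
pose z_ n := iter n F 0.
have zle n : cnorm (z_ n) <= 2^-1.
  elim: n => [|n IH]; first by rewrite cnorm0.
  rewrite /z_ iterS -/(z_ n) cnormZ n2.
  have := ler_cnormD (h * h) (z_ n * z_ n).
  have := ler_cnormM h h; have := ler_cnormM (z_ n) (z_ n).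
  have := cnorm_ge0 h; have := cnorm_ge0 (z_ n); nra.
have Fdiff u v : F u - F v = (2^-1 : R[i]) *: (u * (u - v) + (u - v) * v).
  rewrite -scalerBr; congr (_ *: _).
  by rewrite mulrBr mulrBl opprD addrACA subrr add0r [RHS]addrA subrK.
(* On the ball of radius 1/2 this is a contraction of ratio 1/2. The norm of [v] stays in the bound
   because [v] will also be the limit [l], for which no bound is at hand. *)
have Fle u v : cnorm u <= 2^-1 ->
    cnorm (F u - F v) <= 2^-1 * (2^-1 + cnorm v) * cnorm (u - v).
  move=> u2; rewrite Fdiff cnormZ n2.
  have := ler_cnormD (u * (u - v)) ((u - v) * v).
  have := ler_cnormM u (u - v); have := ler_cnormM (u - v) v.
  have := cnorm_ge0 (u - v); nra.
have zcauchy n p : cnorm (z_ (n + p)%N - z_ n) <= 2^-1 ^+ n.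
  elim: n => [|n IH].
    by rewrite /z_/= subr0 expr0 -/(z_ _); apply: (le_trans (zle _)); lra.
  rewrite addSn /z_ !iterS -!/(z_ _) exprS.
  apply: (le_trans (Fle _ _ (zle _))).
  have := zle n; have := cnorm_ge0 (z_ (n + p)%N - z_ n).
  have := cnorm_ge0 (z_ n); nra.
have [e e0|l] := cnorm_complete z_.
  have [N HN] : exists N, 2^-1 ^+ N < e / 2.
    have := @cvg_expr R 2^-1; rewrite ger0_norm// => /(_ ltac:(lra)).
    move=> /cvgr0Pnorm_lt /(_ (e/2) ltac:(lra)) [N _ HN].
    by exists N; have := HN N (leqnn N); rewrite /= ger0_norm// exprn_ge0.
  exists N => m n Nm Nn.
  have := zcauchy N (m - N)%N; have := zcauchy N (n - N)%N; rewrite !subnKC// => H1 H2.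
  have := ler_cnormD (z_ m - z_ N) (z_ N - z_ n); rewrite addrA subrK [cnorm (z_ N - _)]cnormB.
  lra.
move=> /cnorm_cvgP lim_l.
have approx e : 0 < e -> exists n, cnorm (z_ n - l) < e /\ cnorm (z_ n.+1 - l) < e.
  by move=> /lim_l[N HN]; exists N; split; apply: HN => //; exact: leqnSn.
have z_star n : star (z_ n) = z_ n.
  elim: n => [|n IH]; first exact: star0.
  rewrite /z_ iterS -/(z_ n) /F starZ starD !starM hs IH; congr (_ *: _).
  by rewrite conjc_inv// (conjc_nat _ 2).
have z_comm n : z_ n * h = h * z_ n.
  elim: n => [|n IH]; first by rewrite mulr0 mul0r.
  rewrite /z_ iterS -/(z_ n) /F -scalerAl -scalerAr mulrDl mulrDr [h * (h * h)]mulrA.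
  by congr (_ *: (_ + _)); rewrite -mulrA IH !mulrA IH.
have l_star : star l = l.
  apply/eqP; rewrite -subr_eq0; apply/eqP/(@cnorm_le_eps _ 2) => e /approx[n [ne _]].
  have := ler_cnormD (star l - z_ n) (z_ n - l); rewrite addrA subrK.
  by rewrite -{1}z_star -starB cnorm_star [cnorm (l - _)]cnormB; lra.
have l_comm : l * h = h * l.
  apply/eqP; rewrite -subr_eq0; apply/eqP/(@cnorm_le_eps _ (2 * cnorm h)) => e /approx[n [ne _]].
  have -> : l * h - h * l = h * (z_ n - l) - (z_ n - l) * h.
    by rewrite mulrBr mulrBl z_comm opprB [RHS]addrC addrA subrK.
  have := ler_cnormD (h * (z_ n - l)) (- ((z_ n - l) * h)); rewrite cnormN.
  have := ler_cnormM h (z_ n - l); have := ler_cnormM (z_ n - l) h.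
  have := cnorm_ge0 h; nra.
have l_fix : l = F l.
  apply/eqP; rewrite -subr_eq0; apply/eqP.
  apply/(@cnorm_le_eps _ (1 + 2^-1 * (2^-1 + cnorm l))) => e /approx[n [ne ne']].
  have := ler_cnormD (l - z_ n.+1) (z_ n.+1 - F l); rewrite addrA subrK.
  have := Fle (z_ n) l (zle n); rewrite -/(z_ n.+1).
  rewrite [cnorm (l - z_ _)]cnormB.
  have := cnorm_ge0 l; have := cnorm_ge0 (z_ n - l); nra.
exists (1 - l); split.
- by rewrite starB star1 l_star.
- by rewrite mulrBl mulrBr l_comm mul1r mulr1.
- have l2 : l + l = h * h + l * l.
    rewrite [in LHS]l_fix /F -scalerDl -[RHS]scale1r; congr (_ *: _).
    by rewrite -mulr2n -[X in X *+ 2]mulr1 -mulrnAr mulVf.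
  have -> : h * h = l + l - l * l by rewrite l2 addrK.
  rewrite mulrBr mulr1 mulrBl mul1r !opprB opprD !addrA.
  by rewrite [1 + _ - l - l]addrAC [1 + _ - l]addrAC.
Qed.

End CStarAlgebra.

(** * Homomorphisms: continuity, inverses, preimages; generated subalgebras *)

Section StarHom.
Variable R : realType.
Implicit Types A B : cstarAlgType R.

(* With [y^2 = 1 - h^2], the element [f h + i f y] is unitary, of real part [f h]. *)
Lemma star_hom_selfadjoint_le1 A B (f : A -> B) (h : A) :
  unital_star_hom setT f -> star h = h -> cnorm h <= 2^-1 -> cnorm (f h) <= 1.
Proof.
move=> [f1 fD fZ fM fs] hs hle.
have [y [ys yh yy]] := sqrt_one_sub_sqr hs hle.
set b := f h; set c := f y.
have bs : star b = b by rewrite -fs// hs.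
have cs : star c = c by rewrite -fs// ys.
have cb : c * b = b * c by rewrite -!fM// yh.
have bc1 : b * b + c * c = 1.
  by rewrite -!fM// -fD// yy [h * h + _]addrC subrK.
pose u : B := b + 'i%C *: c.
have us : star u = b - 'i%C *: c.
  rewrite starD starZ bs cs -scaleNr; congr (_ + _ *: _).
  by apply/eqP; rewrite eq_complex/= oppr0 !eqxx.
have u1 : star u * u = 1.
  rewrite us mulrDl !mulrDr !mulNr -!scalerAl -!scalerAr scalerA cb.
  by rewrite addrA addrK -scaleNr -['i%C * _]expr2 sqr_i opprK scale1r bc1.
have bE : b = (2^-1 : R[i]) *: (u + star u).
  rewrite us /u addrACA subrr addr0 -mulr2n -[b *+ 2]scaler_nat.
  by rewrite scalerA mulVf ?scale1r//.
have n2 : Normc.normc (2^-1 : R[i]) = 2^-1.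
  by rewrite Normc.normcV (normcMn 1) Normc.normc1.
rewrite bE cnormZ n2; have := ler_cnormD u (star u).
by rewrite cnorm_star (cnorm_isometry u1); lra.
Qed.

(** Scaling to norm 1/2 gives the self-adjoint case, and the C*-identity applied to [star x * x]
    gives the general one. The best constant is 1; the bound serves only to make [f] continuous. *)
Lemma star_hom_bounded A B (f : A -> B) :
  unital_star_hom setT f -> forall x, cnorm (f x) <= 2 * cnorm x.
Proof.
move=> hf; have [f1 fD fZ fM fs] := hf.
have sa h : star h = h -> cnorm (f h) <= 2 * cnorm h.
  move=> hs; have [h0|hn0] := eqVneq (cnorm h) 0.
    by rewrite (cnorm0_eq0 _ h0) -(scale0r 0) fZ// !scale0r !cnorm0 mulr0.
  have h_gt0 : 0 < cnorm h by rewrite lt_def hn0 cnorm_ge0.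
  pose t : R[i] := ((2 * cnorm h)^-1)%:C%C.
  have tn : Normc.normc t = (2 * cnorm h)^-1.
    by rewrite /t/= expr0n/= addr0 sqrtr_sqr ger0_norm// invr_ge0 mulr_ge0// ltW.
  have ths : star (t *: h) = t *: h by rewrite starZ hs conjc_real.
  have := star_hom_selfadjoint_le1 hf ths; rewrite fZ// !cnormZ tn.
  have -> : (2 * cnorm h)^-1 * cnorm h = 2^-1 by field.
  by move=> /(_ (lexx _)); rewrite mulrC ler_pdivrMr ?mul1r// mulr_gt0.
move=> x; have := sa (star x * x); rewrite starM starK => /(_ erefl).
rewrite fM// fs// !cstar_identity; have := cnorm_ge0 x; have := cnorm_ge0 (f x).
nra.
Qed.

Lemma star_auto_inverse A (f : A -> A) : star_auto setT f ->
  exists g, [/\ unital_star_hom setT g, cancel f g & cancel g f].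
Proof.
move=> [[f1 fD fZ fM fs] [_ finj fsurj]].
have /choice[g gE] y : exists x, f x = y.
  by have [x _ <-] := fsurj y I; exists x.
have fI x y : f x = f y -> x = y by apply: finj; rewrite inE.
have gK x : g (f x) = x by exact: fI.
by exists g; split => //; split => [|x y _ _|a x _|x y _ _|x _]; apply: fI;
  rewrite ?f1 ?fD ?fZ ?fM ?fs ?gE.
Qed.

(** Norm-closedness comes from the boundedness of [f]. Consequently, that [f] sends a generated
    algebra into [X] need only be checked on generators. *)
Lemma preimage_cstar_subalgebra A B (f : A -> B) (X : set B) :
  unital_star_hom setT f -> cstar_subalgebra X -> cstar_subalgebra (f @^-1` X).
Proof.
move=> hf [X0 XD XZ XM Xs Xc]; have [f1 fD fZ fM fs] := hf.
split => /= [|x y|a x|x y|x|x_ l xX /cnorm_cvgP lim].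
- by rewrite -(scale0r 0) fZ// scale0r.
- by rewrite fD//; exact: XD.
- by rewrite fZ//; exact: XZ.
- by rewrite fM//; exact: XM.
- by rewrite fs//; exact: Xs.
- apply: (Xc (f \o x_)) => //; apply/cnorm_cvgP => e e0.
  have [|N HN] := lim (e / 2); first exact: divr_gt0.
  exists N => n /HN.
  have := star_hom_bounded hf (x_ n - l).
  by rewrite fD// -scaleN1r fZ// !scaleN1r/=; lra.
Qed.

Lemma cstar_generated_subalgebra A (G : set A) :
  cstar_subalgebra (cstar_generated G).
Proof.
split=> [X [XA _]|x y xG yG X [XA GX]|a x xG X [XA GX]|x y xG yG X [XA GX]
        |x xG X [XA GX]|x_ l xG lim X [XA GX]].
- exact: csub0.
- by apply: csubD => //; [exact: xG|exact: yG].
- by apply: csubZ => //; exact: xG.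
- by apply: csubM => //; [exact: xG|exact: yG].
- by apply: csub_star => //; exact: xG.
- by apply: (csub_closed XA _ lim) => n; exact: xG.
Qed.

Lemma sub_cstar_generated A (G : set A) : G `<=` cstar_generated G.
Proof. by move=> x Gx X [_]; apply. Qed.

Lemma cstar_generated_min A (G X : set A) :
  cstar_subalgebra X -> G `<=` X -> cstar_generated G `<=` X.
Proof. by move=> XA GX x; apply. Qed.

Lemma csubM3 A (X : set A) x y z :
  cstar_subalgebra X -> X x -> X y -> X z -> X (x * y * z).
Proof. by move=> XA Xx Xy Xz; apply: (csubM XA) => //; exact: (csubM XA). Qed.

End StarHom.

(** * The cohomological equation for a periodic function on the integers *)

Section Cohomology.
Variables (F : fieldType) (k : nat) (c : int -> F) (C : F).
Hypothesis c_neq0 : forall n, c n != 0.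
Hypothesis c_periodic : forall n m, c (n + (2 ^ k)%N%:Z * m) = c n.
Hypothesis c_ends : c (-1) = c 0.
Hypothesis c_jump : forall y, \prod_(i < k.+1)
  (c ((2 ^ i)%N%:Z * (2 * y + 1)) / c ((2 ^ i)%N%:Z * (2 * y + 1) - 1)) = C.

(* The points [2 ^ i * n] and [2 ^ i * (n + 1) - 1] are [n] with [i] binary digits
   0, respectively 1, put in front. *)
Definition transfer0 n := \prod_(i < k) (c 0 / c ((2 ^ i.+1)%N%:Z * n)).
Definition transfer1 n := \prod_(i < k) (c 0 / c ((2 ^ i.+1)%N%:Z * (n + 1) - 1)).

Lemma transfer0_neq0 n : transfer0 n != 0.
Proof. by apply/prodf_neq0 => i _; rewrite mulf_neq0 ?invr_eq0. Qed.

Lemma transfer1_neq0 n : transfer1 n != 0.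
Proof. by apply/prodf_neq0 => i _; rewrite mulf_neq0 ?invr_eq0. Qed.

Let c_mul n : c ((2 ^ k)%N%:Z * n) = c 0.
Proof. by rewrite -[_ * n]add0r c_periodic. Qed.

(** Telescoping: [transfer0 (2 * y)] has the factors of [transfer0 y] shifted by one place, and the
    factor that enters, at a multiple of $2^k$, is 1. *)
Lemma transfer0_even y : c (2 * y) * transfer0 y = c 0 * transfer0 (2 * y).
Proof.
have e (i : nat) : (2 ^ i.+1)%N%:Z * (2 * y) = (2 ^ i.+2)%N%:Z * y.
  by rewrite [in RHS]expnS PoszM mulrCA mulrA.
have := big_ord_recl k (fun i : 'I_k.+1 => c 0 / c ((2 ^ i.+1)%N%:Z * y)) (op := *%R) (idx := 1).
rewrite big_ord_recr/= -/(transfer0 y).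
rewrite (eq_bigr (fun i : 'I_k => c 0 / c ((2 ^ i.+1)%N%:Z * (2 * y)))); last first.
  by move=> i _; rewrite e.
rewrite -/(transfer0 _) expnSr PoszM -mulrA c_mul divff// mulr1 expn1 => ->.
by field.
Qed.

(** The same telescoping; the factor that enters is now [c 0 / c (-1)], which is 1 by [c_ends]. *)
Lemma transfer1_odd y : c (2 * y + 1) * transfer1 y = c 0 * transfer1 (2 * y + 1).
Proof.
have e (i : nat) : (2 ^ i.+1)%N%:Z * (2 * y + 1 + 1) = (2 ^ i.+2)%N%:Z * (y + 1).
  by rewrite [in RHS]expnS PoszM; ring.
have := big_ord_recl k (fun i : 'I_k.+1 => c 0 / c ((2 ^ i.+1)%N%:Z * (y + 1) - 1)) (op := *%R) (idx := 1).
rewrite big_ord_recr/= -/(transfer1 y).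
rewrite (eq_bigr (fun i : 'I_k => c 0 / c ((2 ^ i.+1)%N%:Z * (2 * y + 1 + 1) - 1))); last first.
  by move=> i _; rewrite e.
rewrite -/(transfer1 _) expnSr PoszM -mulrA [_ - 1]addrC c_periodic c_ends divff// mulr1 expn1 => ->.
by rewrite (_ : 2%:Z * (y + 1) - 1 = 2 * y + 1); [field|ring].
Qed.

Let r n := transfer1 n / transfer0 n.

Let r_neq0 n : r n != 0.
Proof. by rewrite mulf_neq0 ?invr_eq0 ?transfer0_neq0 ?transfer1_neq0. Qed.

Let r_periodic n m : r (n + (2 ^ k)%N%:Z * m) = r n.
Proof.
rewrite /r /transfer0 /transfer1; congr (_ / _); apply: eq_bigr => i _.
  rewrite (_ : _ - 1 = (2 ^ i.+1)%N%:Z * (n + 1) - 1 + (2 ^ k)%N%:Z * ((2 ^ i.+1)%N%:Z * m)).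
    by rewrite c_periodic.
  by ring.
rewrite (_ : _ * (n + _) = (2 ^ i.+1)%N%:Z * n + (2 ^ k)%N%:Z * ((2 ^ i.+1)%N%:Z * m)).
  by rewrite c_periodic.
by ring.
Qed.

(** In [c_jump] the factor of index 0 is [c (2 * y + 1) / c (2 * y)], and the others form [transfer1
    (2 * y) / transfer0 (2 * y + 1)]. Replacing the two values of [c] by means of [transfer0_even]
    and [transfer1_odd] leaves only values of [r]. *)
Let r_fold y : r (2 * y) * r (2 * y + 1) = C * r y.
Proof.
have := c_jump y; rewrite big_ord_recl/= expn0 mul1r addrK.
have -> : \prod_(i < k) (c ((2 ^ bump 0 i)%N%:Z * (2 * y + 1)) / c ((2 ^ bump 0 i)%N%:Z * (2 * y + 1) - 1))
   = transfer1 (2 * y) / transfer0 (2 * y + 1).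
  rewrite /transfer0 /transfer1 -prodf_div; apply: eq_bigr => i _.
  by rewrite /bump/= add1n; field; rewrite ?c_neq0.
move=> <-; rewrite /r.
have -> : c (2 * y) = c 0 * transfer0 (2 * y) / transfer0 y.
  by rewrite -transfer0_even mulfK ?transfer0_neq0.
have -> : c (2 * y + 1) = c 0 * transfer1 (2 * y + 1) / transfer1 y.
  by rewrite -transfer1_odd mulfK ?transfer1_neq0.
by field; rewrite ?c_neq0 ?transfer0_neq0 ?transfer1_neq0.
Qed.

Let C_neq0 : C != 0.
Proof.
by apply/eqP => C0; have := r_fold 0; rewrite C0 mul0r => /eqP;
  rewrite mulf_eq0 !(negbTE (r_neq0 _)).
Qed.

(* [f (2 y) * f (2 y + 1) = f y], iterated [k] times, makes the periodic [f] a
   constant [K] with [K * K = K]. *)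
Let r_const y : r y = C.
Proof.
pose f n := r n / C.
have fE n : f (2 * n) * f (2 * n + 1) = f n.
  by rewrite /f mulrACA r_fold; field.
have fprod N n : \prod_(i < 2 ^ N) f ((2 ^ N)%N%:Z * n + i%:Z) = f n.
  elim: N n => [|N IH] n; first by rewrite expn0 big_ord1 mul1r addr0.
  rewrite -fE -(IH (2 * n)) -(IH (2 * n + 1)) -!(big_mkord xpredT (fun i => f (_ + i%:Z))).
  rewrite expnS mul2n -addnn (big_cat_nat (n := 2 ^ N)) ?leq_addr//=; congr (_ * _).
    by apply: eq_bigr => i _; congr (f (_ + _)); rewrite PoszD; ring.
  rewrite -{1}[(2 ^ N)%N]add0n big_addn addnK.
  by apply: eq_bigr => i _; congr f; rewrite !PoszD; ring.
have fper m n : f (n + (2 ^ k)%N%:Z * m) = f n by rewrite /f r_periodic.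
have fconst n : f n = f 0.
  rewrite -(fprod k n) -(fprod k 0); apply: eq_bigr => i _.
  by rewrite mulr0 add0r addrC fper.
have := fE 0; rewrite fconst (fconst (_ + 1)) => f00.
have fn0 : f 0 != 0 by rewrite mulf_neq0 ?invr_eq0.
have : f 0 = 1 by apply: (mulfI fn0); rewrite mulr1.
by rewrite -(fconst y) /f => /(canRL (divfK C_neq0)); rewrite mul1r.
Qed.

(** By [r_const], [transfer1] is [C] times [transfer0], so its equation at odd points passes to
    [transfer0]. *)
Lemma transfer0_odd y : c (2 * y + 1) * transfer0 y = c 0 * transfer0 (2 * y + 1).
Proof.
have tE n : transfer1 n = C * transfer0 n.
  by rewrite -(r_const n) /r divfK ?transfer0_neq0.
apply: (mulfI C_neq0); rewrite mulrCA -tE transfer1_odd tE.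
by rewrite mulrCA.
Qed.

End Cohomology.

(** * Relations between powers of [S] and [U]; diagonal elements as functions *)

Section Words.
Variables (R : realType) (A : cstarAlgType R) (S U : A).
Hypothesis hQ : Q2_relations S U.
Local Notation "x ^#" := (star x).

Let SS : S^# * S = 1. Proof. by case: hQ. Qed.
Let UsU : U^# * U = 1. Proof. by case: hQ => _ []. Qed.
Let UUs : U * U^# = 1. Proof. by case: hQ => _ []. Qed.
Let SU : S * U = U ^+ 2 * S. Proof. by case: hQ. Qed.
Let Ssum : S * S^# + U * S * S^# * U^# = 1. Proof. by case: hQ. Qed.

Definition upow (z : int) : A :=
  match z with Posz n => U ^+ n | Negz n => U^# ^+ n.+1 end.

Lemma upow0 : upow 0 = 1. Proof. exact: expr0. Qed.
Lemma upow1 : upow 1 = U. Proof. exact: expr1. Qed.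

Lemma upowS a : upow (a + 1) = upow a * U.
Proof.
case: a => n /=; first by rewrite addn1 exprSr.
case: n => [|n]; first by rewrite expr1 UsU.
have -> : Negz n.+1 + 1 = Negz n by rewrite !NegzE; lia.
by rewrite [_ ^+ n.+2]exprSr -mulrA UsU mulr1.
Qed.

Lemma upow_pred a : upow (a - 1) = upow a * U^#.
Proof. by rewrite -[in RHS](subrK 1 a) upowS -mulrA UUs mulr1. Qed.

Lemma upowD a b : upow (a + b) = upow a * upow b.
Proof.
elim/int_rect: b => [|n IH|n IH]; first by rewrite addr0 upow0 mulr1.
  by rewrite -addn1 PoszD addrA !upowS IH mulrA.
by rewrite -addn1 PoszD opprD addrA !upow_pred IH mulrA.
Qed.

Lemma star_upow a : (upow a)^# = upow (- a).
Proof.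
elim/int_rect: a => [|n IH|n IH]; first by rewrite oppr0 upow0 star1.
  rewrite -addn1 PoszD upowS starM IH opprD [in RHS]addrC upowD; congr (_ * _).
by rewrite -addn1 PoszD opprD upow_pred starM starK IH opprD opprK [in RHS]addrC upowD upow1.
Qed.

Lemma upowNK a : upow (- a) * upow a = 1.
Proof. by rewrite -upowD addNr upow0. Qed.

Let S_upow a : S * upow a = upow (2 * a) * S.
Proof.
have two n : 2 * (n + 1) = 2 * n + 1 + 1 :> int by ring.
have two' n : 2 * (n - 1) = 2 * n - 1 - 1 :> int by ring.
elim/int_rect: a => [|n IH|n IH]; first by rewrite mulr0 upow0 mul1r mulr1.
  by rewrite -addn1 PoszD two !upowS mulrA IH -!mulrA SU expr2 !mulrA.
have SUs : S * U^# = U^# * (U^# * S).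
  rewrite -[S in RHS]mulr1 -UUs [S * (U * _)]mulrA SU expr2 -!mulrA.
  by rewrite [U^# * (U * _)]mulrA UsU mul1r [U^# * (U * _)]mulrA UsU mul1r.
by rewrite -addn1 PoszD opprD two' !upow_pred mulrA IH -!mulrA SUs.
Qed.

Lemma pow_upow l a : S ^+ l * upow a = upow ((2 ^ l)%N%:Z * a) * S ^+ l.
Proof.
elim: l a => [|l IH] a; first by rewrite mul1r !expr0 mulr1 mul1r.
by rewrite exprSr -mulrA S_upow mulrA IH -mulrA -exprSr expnS; congr (upow _ * _); rewrite PoszM; ring.
Qed.

Lemma starpow_upow l a :
  S^# ^+ l * upow ((2 ^ l)%N%:Z * a) = upow a * S^# ^+ l.
Proof.
have := congr1 star (pow_upow l (- a)); rewrite !starM !star_upow opprK starX => ->.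
by rewrite mulrN opprK.
Qed.

Lemma starpow_pow l : S^# ^+ l * S ^+ l = 1.
Proof.
elim: l => [|l IH]; first by rewrite !expr0 mulr1.
by rewrite exprSr exprS -mulrA [S^# * _]mulrA SS mul1r.
Qed.

(** Compressing [Ssum] by [S] gives [1 + x * x^# = 1] for [x = S^# * U * S]: the ranges of [S] and
    [U * S] are orthogonal. *)
Let SUS0 : S^# * U * S = 0.
Proof.
apply: mul_star_eq0; rewrite !starM starK.
have := congr1 (fun x => S^# * x * S) Ssum.
rewrite mulrDr mulrDl mulr1 !mulrA SS mul1r SS -[1 in RHS]addr0.
by move=> /addrI.
Qed.

(** A translation by [c] maps no multiple of $2^l$ to another one. By induction on [l], an even [c]
    is halved by the innermost pair [S^#], [S], and an odd [c] is killed by [SUS0]. *)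
Lemma compress_ndvd l c :
  ~~ ((2 ^ l)%N%:Z %| c)%Z -> S^# ^+ l * upow c * S ^+ l = 0.
Proof.
elim: l c => [|l IH] c; first by rewrite dvd1z.
have [e|e] : c = 2 * (c %/ 2)%Z \/ c = 2 * (c %/ 2)%Z + 1 by lia.
  rewrite e expnS PoszM dvdz_mul2l// => /IH H.
  rewrite exprSr exprS -!mulrA [upow _ * _]mulrA -S_upow !mulrA.
  by rewrite -[_ * S^# * S]mulrA SS mulr1.
have H : S^# * upow (2 * (c %/ 2)%Z) = upow (c %/ 2)%Z * S^#.
  by have := starpow_upow 1 (c %/ 2)%Z; rewrite !expr1.
move=> _; rewrite e upowS exprSr exprS !mulrA -[_ * S^# * upow _]mulrA H.
by rewrite -!mulrA [U * _]mulrA [S^# * _]mulrA [S^# * _]mulrA SUS0 mul0r !mulr0.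
Qed.

Lemma compress_ndvd_rect p q c : ~~ ((2 ^ minn p q)%N%:Z %| c)%Z ->
  S^# ^+ p * upow c * S ^+ q = 0.
Proof.
have [pq|/ltnW qp] := leqP p q => /compress_ndvd H.
  by rewrite -(subnKC pq) exprD mulrA H mul0r.
by rewrite -(subnK qp) exprD -!mulrA [_ * (upow _ * _)]mulrA H mulr0.
Qed.

Lemma compress_rect_l p q c : (p <= q)%N ->
  S^# ^+ p * upow ((2 ^ p)%N%:Z * c) * S ^+ q = upow c * S ^+ (q - p).
Proof.
by move=> pq; rewrite starpow_upow -{1}(subnKC pq) exprD mulrA -[upow c * _ * _]mulrA starpow_pow mulr1.
Qed.

(** By [Ssum] an element is determined by its products with [S] and [U * S]; this is iterated [k]
    times. *)
Lemma eq_on_cylinders (x y : A) k :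
  (forall n, x * (upow n * S ^+ k) = y * (upow n * S ^+ k)) -> x = y.
Proof.
have step z z' : z * S = z' * S -> z * (U * S) = z' * (U * S) -> z = z'.
  move=> e1 e2; rewrite -[z]mulr1 -[z']mulr1 -Ssum !mulrDr !mulrA.
  by move: e1 e2; rewrite !mulrA => -> ->.
elim: k => [H|k IH H]; first by have := H 0; rewrite upow0 !mulr1.
apply: IH => n; apply: step.
  by have := H n; rewrite exprSr !mulrA.
have := H (n + (2 ^ k)%N%:Z * 1).
by rewrite upowD exprSr -!mulrA [upow (_ * 1) * _]mulrA -pow_upow upow1 !mulrA.
Qed.

(* In the canonical representation on l^2(Z), [upow n * S ^+ l] maps [e_j] to
   [e_(n + 2^l j)]: it stands for the 2-adic ball [n + 2^l Z_2], on which an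
   element of D_2^k with [k <= l] is the constant [f n]. *)
Definition acts k (x : A) (f : int -> R[i]) := forall n l, (k <= l)%N ->
  x * (upow n * S ^+ l) = f n *: (upow n * S ^+ l) /\
  x^# * (upow n * S ^+ l) = (f n)^*%C *: (upow n * S ^+ l).

Lemma acts1 k : acts k 1 (fun=> 1).
Proof. by move=> n l _; rewrite star1 conjc1 !mul1r scale1r. Qed.

Lemma actsD k x y f g : acts k x f -> acts k y g -> acts k (x + y) (fun n => f n + g n).
Proof.
move=> hx hy n l kl; have [x1 x2] := hx n l kl; have [y1 y2] := hy n l kl.
by rewrite starD !mulrDl x1 x2 y1 y2 rmorphD/= !scalerDl.
Qed.

Lemma actsZ k a x f : acts k x f -> acts k (a *: x) (fun n => a * f n).
Proof.
move=> hx n l kl; have [x1 x2] := hx n l kl.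
by rewrite starZ -!scalerAl x1 x2 !scalerA rmorphM/=.
Qed.

Lemma actsM k x y f g : acts k x f -> acts k y g -> acts k (x * y) (fun n => f n * g n).
Proof.
move=> hx hy n l kl; have [x1 x2] := hx n l kl; have [y1 y2] := hy n l kl.
rewrite starM -!mulrA y1 x2 -!scalerAr x1 y2 !scalerA rmorphM/=.
by rewrite [g n * _]mulrC.
Qed.

Lemma acts_star k x f : acts k x f -> acts k x^# (fun n => (f n)^*%C).
Proof. by move=> hx n l kl; have [x1 x2] := hx n l kl; rewrite starK conjcK. Qed.

(** [S] carries the ball at [n] to the ball at [2 * n], whose radius is smaller, so that [k <= l] is
    preserved. *)
Lemma acts_compress k x f : acts k x f ->
  acts k (S^# * x * S) (fun n => f (2 * n)).
Proof.
move=> hx n l kl; have [x1 x2] := hx (2 * n) l.+1 (leqW kl).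
have e : S * (upow n * S ^+ l) = upow (2 * n) * S ^+ l.+1.
  by rewrite mulrA S_upow -mulrA -exprS.
have e' : S^# * (upow (2 * n) * S ^+ l.+1) = upow n * S ^+ l.
  by rewrite -e mulrA SS mul1r.
by rewrite !starM starK -!mulrA e x1 x2 -!scalerAr e'.
Qed.

Lemma upow_pow_isometry n l :
  (upow n * S ^+ l)^# * (upow n * S ^+ l) = 1.
Proof.
by rewrite starM star_upow starX -mulrA [upow (- n) * _]mulrA upowNK mul1r starpow_pow.
Qed.

Lemma upow_pow_neq0 n l : upow n * S ^+ l != 0.
Proof.
apply/eqP => e; have := upow_pow_isometry n l; rewrite e mulr0 => /esym/eqP.
by rewrite oner_eq0.
Qed.

Lemma upow_pow_inj n l (a b : R[i]) :
  a *: (upow n * S ^+ l) = b *: (upow n * S ^+ l) -> a = b.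
Proof.
move=> /eqP; rewrite -subr_eq0 -scalerBl scaler_eq0 (negbTE (upow_pow_neq0 _ _)).
by rewrite orbF subr_eq0 => /eqP.
Qed.

(** At level [k] the isometries at the two points differ by the right factor [upow m], which
    multiplication by [x] on the left does not see. *)
Lemma acts_periodic k x f : acts k x f ->
  forall n m, f (n + (2 ^ k)%N%:Z * m) = f n.
Proof.
move=> hx n m; have [x1 _] := hx (n + (2 ^ k)%N%:Z * m) k (leqnn k).
apply: (@upow_pow_inj (n + (2 ^ k)%N%:Z * m) k); rewrite -x1.
have [x2 _] := hx n k (leqnn k).
by rewrite upowD -!mulrA -pow_upow ![upow n * (_ * _)]mulrA mulrA x2 -scalerAl.
Qed.

Lemma acts_comm k x y f g : acts k x f -> acts k y g -> x * y = y * x.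
Proof.
move=> hx hy; apply: (@eq_on_cylinders _ _ k) => n.
have [-> _] := actsM hx hy n (leqnn k); have [-> _] := actsM hy hx n (leqnn k).
by rewrite mulrC.
Qed.

Lemma acts_unitary k x f : acts k x f -> (forall n, f n * (f n)^*%C = 1) ->
  unitary x.
Proof.
move=> hx f1; have hs := acts_star hx; split; apply: (@eq_on_cylinders _ _ k) => n.
  by have [-> _] := actsM hs hx n (leqnn k); rewrite mulrC f1 scale1r mul1r.
by have [-> _] := actsM hx hs n (leqnn k); rewrite f1 scale1r mul1r.
Qed.

Lemma acts_unitary_value k x f : acts k x f -> unitary x ->
  forall n, f n * (f n)^*%C = 1.
Proof.
move=> hx [_ x1] n; apply: (@upow_pow_inj n k); rewrite scale1r.
by have [<- _] := actsM hx (acts_star hx) n (leqnn k); rewrite x1 mul1r.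
Qed.

Lemma monomialE (s : seq 'I_2) :
  exists a, \prod_(i <- s) gen S U i = upow a * S ^+ size s.
Proof.
elim: s => [|i s [a IH]]; first by exists 0; rewrite big_nil upow0 expr0 mulr1.
have [b gE] : exists b, gen S U i = upow b * S.
  rewrite /gen; case: ifP => _; first by exists 1; rewrite upow1.
  by exists 0; rewrite upow0 mul1r.
exists (b + 2 * a); rewrite big_cons IH gE -mulrA [S * _]mulrA S_upow.
by rewrite upowD exprS !mulrA.
Qed.

(** The projection stands for a ball $a + 2^k \mathbb{Z}_2$. For [k <= l] the ball at [n] lies
    inside it or is disjoint from it, so the value is an indicator function. *)
Lemma acts_proj k (alpha : k.-tuple 'I_2) : exists f, acts k (Defs.proj S U alpha) f.
Proof.
have [a mE] := monomialE alpha; rewrite size_tuple in mE.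
exists (fun n => ((2 ^ k)%N%:Z %| n - a)%Z%:R) => n l kl.
have ps : (Defs.proj S U alpha)^# = Defs.proj S U alpha by rewrite /Defs.proj starM starK.
rewrite ps conjc_nat /Defs.proj /monomial mE starM star_upow starX.
suff -> : upow a * S ^+ k * (S^# ^+ k * upow (- a)) * (upow n * S ^+ l) =
    ((2 ^ k)%N%:Z %| n - a)%Z%:R *: (upow n * S ^+ l) by [].
rewrite -!mulrA [upow (- a) * _]mulrA -upowD [- a + n]addrC.
case: (boolP (_ %| _)%Z) => [/dvdzP[b e]|nd].
  rewrite e [b * _]mulrC [S^# ^+ k * _]mulrA compress_rect_l// [S ^+ k * _]mulrA pow_upow.
  by rewrite -mulrA -exprD subnKC// mulrA -upowD [_ * b]mulrC -e [a + _]addrC subrK scale1r.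
rewrite scale0r -(subnKC kl) exprD [S^# ^+ k * _]mulrA mulrA [S^# ^+ k * _ * _]mulrA.
by rewrite compress_ndvd// mul0r mulr0.
Qed.

Lemma acts_D2_level k d : D2_level S U k d -> exists f, acts k d f.
Proof.
move=> [c ->]; apply: (big_ind (fun x => exists f, acts k x f)).
- by exists (fun=> 0) => n l _; rewrite star0 conjc0 !mul0r scale0r.
- by move=> x y [f hf] [g hg]; eexists; apply: actsD; eassumption.
- by move=> al _; have [f hf] := acts_proj al; eexists; apply: actsZ; eassumption.
Qed.

Lemma O2_gen i : O2 S U (gen S U i).
Proof. by apply: sub_cstar_generated; exists i. Qed.

Lemma O2_subalgebra : cstar_subalgebra (O2 S U).
Proof. exact: cstar_generated_subalgebra. Qed.

Lemma O2_S : O2 S U S.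
Proof. exact: (O2_gen (@Ordinal 2 1 isT)). Qed.

(** A [cstar_subalgebra] is not unital by definition; here the unit is [S^# * S]. *)
Lemma O2_1 : O2 S U 1.
Proof.
have H := O2_subalgebra; rewrite -SS; apply: (csubM H); last exact: O2_S.
by apply: (csub_star H); exact: O2_S.
Qed.

Lemma O2_proj k (al : k.-tuple 'I_2) : O2 S U (Defs.proj S U al).
Proof.
have H := O2_subalgebra.
have M : O2 S U (monomial S U al).
  apply: big_ind => [||i _]; [exact: O2_1|exact: csubM|exact: O2_gen].
by apply: (csubM H) => //; exact: (csub_star H).
Qed.

Lemma O2_D2_level k d : D2_level S U k d -> O2 S U d.
Proof.
have H := O2_subalgebra; move=> [c ->]; apply: big_ind => [||al _].
- exact: csub0.
- exact: csubD.
- by apply: (csubZ H); exact: O2_proj.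
Qed.

(** The letter prefixes the lowest binary digit [e]: 1 for $S_1$ (index 0) and 0 for $S_2$ (index
    1). *)
Lemma gen_upow i n l : exists e, (e = 0 \/ e = 1) /\
  gen S U i * (upow n * S ^+ l) = upow (2 * n + e) * S ^+ l.+1.
Proof.
rewrite /gen; case: ifP => _; [exists 1|exists 0]; split; auto.
  by rewrite mulrA -[U * S * _]mulrA S_upow addrC upowD upow1 exprS !mulrA.
by rewrite mulrA S_upow addr0 exprS !mulrA.
Qed.

End Words.

(** * Density of the words, and their compressions to balls near 0 *)

Section DenseSpan.
Variables (R : realType) (A : cstarAlgType R) (S U : A).
Hypothesis hQ : Q2_relations S U.
Local Notation "x ^#" := (star x).

Definition word a p q b : A := upow U a * S ^+ p * S^# ^+ q * upow U b.

Inductive word_span : A -> Prop :=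
| word_span0 : word_span 0
| word_span_cons (c : R[i]) a p q b x :
    word_span x -> word_span (c *: word a p q b + x).

Lemma word_span_word a p q b : word_span (word a p q b).
Proof. by rewrite -[word _ _ _ _]scale1r -[_ *: _]addr0; do 2 constructor. Qed.

Lemma word_spanD x y : word_span x -> word_span y -> word_span (x + y).
Proof.
by move=> hx hy; elim: hx => [|c a p q b z _ IH]; rewrite ?add0r -?addrA//; constructor.
Qed.

Lemma word_spanZ (c : R[i]) x : word_span x -> word_span (c *: x).
Proof.
elim=> [|c' a p q b z _ IH]; first by rewrite scaler0; constructor.
by rewrite scalerDr scalerA; constructor.
Qed.

Lemma star_word a p q b : (word a p q b)^# = word (- b) q p (- a).
Proof. by rewrite /word !starM !(star_upow hQ) !starX starK !mulrA. Qed.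

Lemma word_span_star x : word_span x -> word_span x^#.
Proof.
elim=> [|c a p q b z _ IH]; first by rewrite star0; constructor.
by rewrite starD starZ star_word; constructor.
Qed.

(** In a product of two words the middle part [S^# ^+ q * upow U (b + a') * S ^+ p'] either vanishes
    or, for [q <= p'], becomes a power of [U] times a power of [S]. The case [p' < q] follows by
    taking adjoints. *)
Lemma word_spanM x y : word_span x -> word_span y -> word_span (x * y).
Proof.
have le_case a p q b a' p' q' b' : (q <= p')%N ->
    word_span (word a p q b * word a' p' q' b').
  move=> qp; have -> : word a p q b * word a' p' q' b' =
      upow U a * S ^+ p * (S^# ^+ q * upow U (b + a') * S ^+ p') * (S^# ^+ q' * upow U b').
    by rewrite (upowD hQ) /word !mulrA.
  case: (boolP ((2 ^ q)%N%:Z %| b + a')%Z) => [/dvdzP[e ->]|nd].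
    rewrite [e * _]mulrC compress_rect_l// !mulrA -[_ * S ^+ p * _]mulrA pow_upow//.
    rewrite !mulrA -(upowD hQ) -[_ * S ^+ p * _]mulrA -exprD.
    exact: (word_span_word (a + (2 ^ p)%N%:Z * e) (p + (p' - q)) q' b').
  rewrite compress_ndvd_rect ?mulr0 ?mul0r; first exact: word_span0.
  by [].
  by rewrite (minn_idPl qp).
have words a p q b a' p' q' b' : word_span (word a p q b * word a' p' q' b').
  have [/le_case|/ltnW le] := leqP q p'; first exact.
  rewrite -[_ * _]starK starM !star_word; apply: word_span_star; exact: le_case.
move=> hx hy; elim: hx => [|c a p q b x' _ IH]; first by rewrite mul0r; constructor.
rewrite mulrDl; apply: word_spanD => //; rewrite -scalerAl; apply: word_spanZ.
elim: hy => [|c' a' p' q' b' y' _ IH']; first by rewrite mulr0; constructor.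
rewrite mulrDr; apply: word_spanD => //; rewrite -scalerAr; exact: word_spanZ.
Qed.

Definition word_closure : set A :=
  [set x | forall e, 0 < e -> exists2 y, word_span y & cnorm (x - y) < e].

Lemma word_closure_subalgebra : cstar_subalgebra word_closure.
Proof.
split=> [e e0|x y hx hy e e0|a x hx e e0|x y hx hy e e0|x hx e e0|x_ l hx /cnorm_cvgP lim e e0].
- by exists 0; [constructor|rewrite subrr cnorm0].
- have [x' sx nx] := hx (e / 2) ltac:(exact: divr_gt0).
  have [y' sy ny] := hy (e / 2) ltac:(exact: divr_gt0).
  exists (x' + y'); first exact: word_spanD.
  rewrite opprD addrACA; have := ler_cnormD (x - x') (y - y'); lra.
- have a0 : 0 <= Normc.normc a by case: (a) => ? ?; exact: sqrtr_ge0.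
  have d0 : 0 < Normc.normc a + 1 by lra.
  have [y sy ny] := hx (e / (Normc.normc a + 1)) ltac:(exact: divr_gt0).
  exists (a *: y); first exact: word_spanZ.
  rewrite -scalerBr cnormZ; have := cnorm_ge0 (x - y).
  by move: ny; rewrite ltr_pdivlMr//; nra.
(* The bound 1 on [e'] gives [cnorm y' <= cnorm y + 1], and the total error is then below
   [e' * K]. *)
- pose K := cnorm x + cnorm y + 1.
  have K0 : 0 < K by have := cnorm_ge0 x; have := cnorm_ge0 y; rewrite /K; lra.
  pose e' := Num.min 1 (e / K).
  have e'0 : 0 < e' by rewrite lt_min ltr01 divr_gt0.
  have [x' sx nx] := hx e' e'0; have [y' sy ny] := hy e' e'0.
  exists (x' * y'); first exact: word_spanM.
  have e1 : e' <= 1 by rewrite ge_min lexx.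
  have e2 : e' * K <= e by rewrite -ler_pdivlMr// ge_min lexx orbT.
  have -> : x * y - x' * y' = x * (y - y') + (x - x') * y'.
    by rewrite mulrBr mulrBl addrA subrK.
  have := ler_cnormD (x * (y - y')) ((x - x') * y').
  have := ler_cnormM x (y - y'); have := ler_cnormM (x - x') y'.
  have ny' : cnorm y' <= cnorm y + 1.
    have := ler_cnormD y (y' - y); rewrite addrC subrK [cnorm (y' - y)]cnormB.
    lra.
  have h1 : cnorm x * cnorm (y - y') <= cnorm x * e'.
    by apply: ler_wpM2l; [exact: cnorm_ge0|exact: ltW].
  have h2 : cnorm (x - x') * cnorm y' <= cnorm (x - x') * (cnorm y + 1).
    by apply: ler_wpM2l => //; exact: cnorm_ge0.
  have h3 : cnorm (x - x') * (cnorm y + 1) < e' * (cnorm y + 1).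
    by rewrite ltr_pM2r//; have := cnorm_ge0 y; lra.
  by move: e2; rewrite /K !mulrDr mulr1; move: h3; rewrite mulrDr; lra.
- have [y sy ny] := hx e e0; exists y^#; first exact: word_span_star.
  by rewrite -starB cnorm_star.
- have [N HN] := lim (e / 2) ltac:(exact: divr_gt0).
  have [y sy ny] := hx N (e / 2) ltac:(exact: divr_gt0).
  exists y => //; have := HN N (leqnn N); have := ler_cnormD (l - x_ N) (x_ N - y).
  by rewrite addrA subrK cnormB [cnorm (l - _)]cnormB; lra.
Qed.

Lemma generated_word_closure x : cstar_generated [set S; U] x -> word_closure x.
Proof.
apply: cstar_generated_min; first exact: word_closure_subalgebra.
move=> y yG e e0; exists y; last by rewrite subrr cnorm0.
have [->|->] := yG.
  have := word_span_word 0 1 0 0.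
  by rewrite /word upow0 !expr0 expr1 !mul1r !mulr1.
have := word_span_word 1 0 0 0.
by rewrite /word upow0 upow1 !expr0 !mulr1.
Qed.

Variable k : nat.
Hypothesis k_gt0 : (0 < k)%N.
(* For odd [j] the range is a 2-adic ball close to 0 that misses 0 and whose
   radius is smaller than its distance to 0.  A word that fixes 0 without being
   the identity near 0 moves every point of the ball out of it. *)
Definition ball_isometry m j := upow U ((2 ^ m)%N%:Z * j) * S ^+ (m + k).

(** On points the word is the affine map $n \mapsto 2^p (n + b) / 2^q + a$, defined where $2^q$
    divides $n + b$. If it is undefined near 0, has no values near 0, moves 0, or scales by $2^{p-q}
    \neq 1$, it carries the ball off itself and the scalar is 0. Otherwise it is the identity near 0
    and the scalar is 1. *)
Lemma word_limit a p q b : exists (x : R[i]) M, forall m y, (M <= m)%N ->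
  let T := ball_isometry m (2 * y + 1) in T^# * word a p q b * T = x%:A.
Proof.
have split_pow m r (z : int) : (r <= m)%N -> (2 ^ m)%N%:Z * z = (2 ^ r)%N%:Z * ((2 ^ (m - r))%N%:Z * z).
  by move=> rm; rewrite -{1}(subnKC rm) expnD PoszM mulrA.
have zero : (exists M, forall m y, (M <= m)%N ->
    let T := ball_isometry m (2 * y + 1) in T^# * word a p q b * T = 0) -> 
  exists (x : R[i]) M, forall m y, (M <= m)%N ->
    let T := ball_isometry m (2 * y + 1) in T^# * word a p q b * T = x%:A.
  by move=> [M H]; exists 0, M => m y mM /=; rewrite (H m y mM) scale0r.
have TwT m j : (ball_isometry m j)^# * word a p q b * ball_isometry m j =
    (S^# ^+ (m + k) * upow U (a - (2 ^ m)%N%:Z * j) * S ^+ p) *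
    (S^# ^+ q * upow U (b + (2 ^ m)%N%:Z * j) * S ^+ (m + k)).
  rewrite /ball_isometry /word starM (star_upow hQ) starX [a - _]addrC !(upowD hQ).
  by rewrite !mulrA.
case: (boolP ((2 ^ p)%N%:Z %| a)%Z) => [/dvdzP[a' aE]|na]; last first.
  apply: zero; exists p => m y pm /=; rewrite TwT compress_ndvd_rect ?mul0r//.
  rewrite (minn_idPr _) ?leq_addr ?(leq_trans pm) ?leq_addr//.
  by rewrite (split_pow _ p)// rpredBr// dvdz_mulr.
case: (boolP ((2 ^ q)%N%:Z %| b)%Z) => [/dvdzP[b' bE]|nb]; last first.
  apply: zero; exists q => m y qm /=; rewrite TwT [X in _ * X]compress_ndvd_rect ?mulr0//.
  rewrite (minn_idPl _) ?(leq_trans qm) ?leq_addr//.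
  by rewrite (split_pow _ q)// rpredDr// dvdz_mulr.
have TwT' m j : (p <= m)%N -> (q <= m)%N ->
    (ball_isometry m j)^# * word a p q b * ball_isometry m j =
    S^# ^+ (m + k - p) * upow U (a' + b' + ((2 ^ (m - q))%N%:Z * j - (2 ^ (m - p))%N%:Z * j))
      * S ^+ (m + k - q).
  move=> pm qm; rewrite TwT.
  have -> : b + (2 ^ m)%N%:Z * j = (2 ^ q)%N%:Z * (b' + (2 ^ (m - q))%N%:Z * j).
    by rewrite bE (split_pow _ q)//; ring.
  rewrite compress_rect_l//; last by rewrite (leq_trans qm) ?leq_addr.
  have -> : S^# ^+ (m + k) * upow U (a - (2 ^ m)%N%:Z * j) * S ^+ p =
      S^# ^+ (m + k - p) * upow U (a' - (2 ^ (m - p))%N%:Z * j).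
    have -> : a - (2 ^ m)%N%:Z * j = (2 ^ p)%N%:Z * (a' - (2 ^ (m - p))%N%:Z * j).
      by rewrite aE (split_pow _ p)//; ring.
    have pmk : (p <= m + k)%N by rewrite (leq_trans pm) ?leq_addr.
    rewrite -{1}(subnK pmk) exprD -!mulrA [S^# ^+ p * _]mulrA starpow_upow//.
    by rewrite -mulrA (starpow_pow hQ) mulr1.
  rewrite -!mulrA [upow U _ * (upow U _ * _)]mulrA -(upowD hQ).
  by congr (_ * (upow U _ * _)); ring.
have dvd2 r r' (z : int) : (r <= r')%N -> ((2 ^ r)%N%:Z %| (2 ^ r')%N%:Z * z)%Z.
  by move=> rr; apply: dvdz_mulr; exact: dvdn_exp2l.
have [s0|s0] := eqVneq (a' + b') 0; last first.
  (* For such [m] all the powers of 2 involved are at least $2^s$ with $s = |a' + b'|$. A nonzero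
     compression would make $2^s$ divide the nonzero number $a' + b'$, although $2^s > s$. *)
  apply: zero; exists (p + q + absz (a' + b')%R)%N => m y mM /=.
  rewrite TwT' ?compress_ndvd_rect//; try lia.
  apply/negP => H.
  have : ((2 ^ absz (a' + b')%R)%N%:Z %| a' + b')%Z.
    have -> : a' + b' = (a' + b' + ((2 ^ (m - q))%N%:Z * (2 * y + 1) - (2 ^ (m - p))%N%:Z * (2 * y + 1)))
      - ((2 ^ (m - q))%N%:Z * (2 * y + 1) - (2 ^ (m - p))%N%:Z * (2 * y + 1)) by rewrite addrK.
    apply: rpredB; last by apply: rpredB; apply: dvd2; lia.
    apply: dvdz_trans H; rewrite /dvdz/=; apply: dvdn_exp2l; lia.
  rewrite /dvdz/= => /dvdn_leq; rewrite absz_gt0 => /(_ s0).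
  by rewrite leqNgt ltn_expl.
have nz r y : ~~ ((2 ^ r.+1)%N%:Z %| (2 ^ r)%N%:Z * (2 * y + 1))%Z.
  rewrite expnSr PoszM dvdz_mul2l; first by lia.
  by rewrite -lt0n expn_gt0.
(* For [p != q] the remaining exponent of [U] is $2^{m - \max(p, q)}$ times an odd number. As
   [k > 0], it is not divisible by $2^{m + k - \max(p, q)}$. *)
have [pq|qp|pq] := ltngtP p q; last first.
- exists 1, p => m y pm /=; rewrite TwT' -?pq// s0 subrr addr0 upow0 mulr1 scale1r.
  exact: starpow_pow hQ _.
- apply: zero; exists p => m y pm /=; rewrite TwT' ?compress_ndvd_rect//; try lia.
  rewrite s0 add0r (_ : minn _ _ = (m + k - p)%N); last lia.
  have -> : (2 ^ (m - q))%N%:Z * (2 * y + 1) = (2 ^ (m - p))%N%:Z * ((2 ^ (p - q))%N%:Z * (2 * y + 1)).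
    by rewrite (_ : m - q = (m - p) + (p - q))%N ?expnD ?PoszM ?mulrA//; lia.
  rewrite -mulrBr; apply/negP => H.
  have /dvdz_trans/(_ H) : ((2 ^ (m - p).+1)%N%:Z %| (2 ^ (m + k - p))%N%:Z)%Z.
    by apply: dvdn_exp2l; lia.
  have -> : (2 ^ (p - q))%N%:Z * (2 * y + 1) - (2 * y + 1) = 2 * ((2 ^ (p - q).-1)%N%:Z * (2 * y + 1) - y - 1) + 1.
    rewrite (_ : p - q = (p - q).-1.+1)%N ?expnS ?PoszM/=; [ring|lia].
  by rewrite (negbTE (nz _ _)).
- apply: zero; exists q => m y qm /=; rewrite TwT' ?compress_ndvd_rect//; try lia.
  rewrite s0 add0r (_ : minn _ _ = (m + k - q)%N); last lia.
  have -> : (2 ^ (m - p))%N%:Z * (2 * y + 1) = (2 ^ (m - q))%N%:Z * ((2 ^ (q - p))%N%:Z * (2 * y + 1)).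
    by rewrite (_ : m - p = (m - q) + (q - p))%N ?expnD ?PoszM ?mulrA//; lia.
  rewrite -mulrBr; apply/negP => H.
  have /dvdz_trans/(_ H) : ((2 ^ (m - q).+1)%N%:Z %| (2 ^ (m + k - q))%N%:Z)%Z.
    by apply: dvdn_exp2l; lia.
  have -> : (2 * y + 1) - (2 ^ (q - p))%N%:Z * (2 * y + 1) = 2 * (y - (2 ^ (q - p).-1)%N%:Z * (2 * y + 1)) + 1.
    rewrite (_ : q - p = (q - p).-1.+1)%N ?expnS ?PoszM/=; [ring|lia].
  by rewrite (negbTE (nz _ _)).
Qed.

Lemma word_span_limit x : word_span x -> exists (c : R[i]) M, forall m y, (M <= m)%N ->
  let T := ball_isometry m (2 * y + 1) in T^# * x * T = c%:A.
Proof.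
elim=> [|c a p q b z _ [c' [M' H']]]; first by exists 0, 0%N => m y _ /=; rewrite mulr0 mul0r scale0r.
have [c1 [M1 H1]] := word_limit a p q b.
exists (c * c1 + c'), (maxn M1 M') => m y; rewrite geq_max => /andP[/H1 e1 /H' e2] /=.
by rewrite mulrDr mulrDl e2 -scalerAr -scalerAl e1 scalerDl scalerA.
Qed.

(** Compression by an isometry does not increase the norm, so both scalars are within [e / 2] of the
    common limit scalar of a nearby combination of words. The bound [M] is uniform in [y] and
    [y']. *)
Lemma ball_compression_cauchy x e : cstar_generated [set S; U] x -> 0 < e ->
  exists M, forall m y m' y' (c c' : R[i]), (M <= m)%N -> (M <= m')%N ->
    let T := ball_isometry m (2 * y + 1) in
    let T' := ball_isometry m' (2 * y' + 1) in
    T^# * x * T = c%:A -> T'^# * x * T' = c'%:A -> Normc.normc (c - c') < e.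
Proof.
move=> /generated_word_closure hx e0.
have [z sz nz] := hx (e / 2) ltac:(exact: divr_gt0).
have [c0 [M H]] := word_span_limit sz.
have T1 m j : cnorm (ball_isometry m j) = 1.
  by apply: cnorm_isometry; exact: upow_pow_isometry.
have close m y (c : R[i]) : (M <= m)%N ->
    let T := ball_isometry m (2 * y + 1) in
    T^# * x * T = c%:A -> Normc.normc (c - c0) < e / 2.
  move=> /(H m y) /= eT ex.
  have -> : Normc.normc (c - c0) = cnorm ((c - c0) *: (1 : A)) by rewrite cnormZ cnorm1 mulr1.
  rewrite scalerBl -eT -ex -mulrBl -mulrBr; apply: le_lt_trans nz.
  apply: (le_trans (ler_cnormM _ _)); rewrite T1 mulr1.
  by apply: (le_trans (ler_cnormM _ _)); rewrite cnorm_star T1 mul1r.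
exists M => m y m' y' c c' mM mM' /= /(close _ _ _ mM) h /(close _ _ _ mM') h'.
have -> : c - c' = (c - c0) - (c' - c0) by rewrite opprB addrA subrK.
have := le_normcD (c - c0) (- (c' - c0)); rewrite normcN.
lra.
Qed.

End DenseSpan.

(** * Complex numbers of modulus 1 *)

Section UnimodularScalars.
Variable R : realType.

Lemma normc_unimodular (z : R[i]) : z * z^*%C = 1 -> Normc.normc z = 1.
Proof.
move=> z1; have := congr1 (@Normc.normc R) z1.
have -> : Normc.normc (z * z^*%C) = Normc.normc z * Normc.normc z.
  by rewrite Normc.normcM; congr (_ * _); case: (z) => a b /=; rewrite sqrrN.
rewrite Normc.normc1 -expr2 => /eqP; rewrite sqrp_eq1; first by move/eqP.
by case: (z) => a b; exact: sqrtr_ge0.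
Qed.

Lemma unimodular_neq0 (z : R[i]) : z * z^*%C = 1 -> z != 0.
Proof. by move=> z1; apply/eqP => z0; move: z1; rewrite z0 mul0r => /esym/eqP; rewrite oner_eq0. Qed.

Lemma normc_lt_eps (z : R[i]) : (forall e : R, 0 < e -> Normc.normc z < e) -> z = 0.
Proof.
move=> H; apply: Normc.eq0_normc; apply/eqP; rewrite eq_le; apply/andP; split.
  by apply/ler_addgt0Pl => e e0; rewrite addr0 ltW// H.
by case: (z) => a b; exact: sqrtr_ge0.
Qed.

Lemma unimodular_polar (z : R[i]) : z * z^*%C = 1 ->
  exists theta : R, z = (cos theta +i* sin theta)%C.
Proof.
case: z => a b; rewrite /= => /eqP; rewrite eq_complex/= => /andP[/eqP ab _].
have {}ab : a ^+ 2 + b ^+ 2 = 1 by rewrite -ab; ring.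
have a1 : -1 <= a <= 1 by apply/andP; split; nra.
have sinE : sin (acos a) = `|b|.
  by rewrite sin_acos// -sqrtr_sqr; congr Num.sqrt; rewrite -ab; ring.
have cosE : cos (acos a) = a by apply: acosK; rewrite in_itv.
have [b0|b0] := leP 0 b.
  by exists (acos a); rewrite cosE sinE ger0_norm.
by exists (- acos a); rewrite cosN sinN cosE sinE ltr0_norm// opprK.
Qed.

End UnimodularScalars.

(** * The image of [U] under the extension, on balls near 0 *)

Section Jump.
Variables (R : realType) (A : cstarAlgType R) (S U : A).
Hypothesis hQ : Q2_relations S U.
Hypothesis hgen : cstar_generated [set S; U] = setT.
Variables (k : nat) (d W : A) (c : int -> R[i]).
Hypothesis k_gt0 : (0 < k)%N.
Hypothesis d_acts : acts S U k d c.
Hypothesis c_unimod : forall n, c n * (c n)^*%C = 1.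
(** [W] stands for the image of [U]. The two equations are the image of $S_1 = U S_2$, which goes to
    $d S_1$, and of $S_2 U = U^2 S_2$. *)
Hypothesis WdS : W * (d * S) = d * (U * S).
Hypothesis WWdS : W * W * (d * S) = d * S * W.
Local Notation "x ^#" := (star x).

Definition jump m y := \prod_(i < m.+1)
  (c ((2 ^ i)%N%:Z * (2 * y + 1)) / c ((2 ^ i)%N%:Z * (2 * y + 1) - 1)).

Let c_neq0 n : c n != 0. Proof. exact: unimodular_neq0. Qed.

Let S_ball n l : S * (upow U n * S ^+ l) = upow U (2 * n) * S ^+ l.+1.
Proof. by have := pow_upow hQ 1 n; rewrite !expr1 mulrA => ->; rewrite exprS mulrA. Qed.

(** [WdS] gives the passage from an even point to the next odd one, which is the case [m = 0]. For
    the induction, put $z = 2^m (2y + 1)$ and apply [WWdS] at $z - 1$: the right side crosses from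
    $z - 1$ to $z$ and then doubles, the left side goes from $2z - 2$ through $2z - 1$ to $2z$, and
    its first half is known from [WdS]. *)
Lemma ext_jump m y :
  W * (upow U ((2 ^ m)%N%:Z * (2 * y + 1) - 1) * S ^+ (m + k)) =
  jump m y *: (upow U ((2 ^ m)%N%:Z * (2 * y + 1)) * S ^+ (m + k)).
Proof.
have dE n l : (k <= l)%N -> d * (upow U n * S ^+ l) = c n *: (upow U n * S ^+ l).
  by move=> kl; have [] := d_acts n kl.
elim: m => [|m IH].
  rewrite /jump big_ord_recl big_ord0 mulr1 expn0 !mul1r addrK add0n.
  (* The exponent is [k.-1] because the factor [S] in [WdS] raises the level to [k], where [d] acts
     as a scalar. *)
  have := congr1 (fun x => x * (upow U y * S ^+ k.-1)) WdS.
  rewrite -!mulrA S_ball prednK// !dE// -!scalerAr.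
  have -> : U * (upow U (2 * y) * S ^+ k) = upow U (2 * y + 1) * S ^+ k.
    by rewrite mulrA -(upow1 U) -(upowD hQ) addrC.
  rewrite dE// => e; apply: (scalerI (c_neq0 (2 * y))); rewrite e scalerA.
  by congr (_ *: _); rewrite mulrCA divff// mulr1.
set j := 2 * y + 1 in IH *; set z := (2 ^ m)%N%:Z * j in IH *.
have e2 : (2 ^ m.+1)%N%:Z * j = 2 * z by rewrite expnS PoszM /z mulrA.
have kl : (k <= (m + k).+1)%N by lia.
have := congr1 (fun x => x * (upow U (z - 1) * S ^+ (m + k))) WWdS.
rewrite -!mulrA S_ball IH -!scalerAr S_ball !dE// -!scalerAr.
have /= -> : W * (upow U (2 * (z - 1)) * S ^+ (m + k).+1) =
    (c (2 * (z - 1)))^-1 *: (c (2 * (z - 1) + 1) *: (upow U (2 * (z - 1) + 1) * S ^+ (m + k).+1)).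
  have := congr1 (fun x => x * (upow U (z - 1) * S ^+ (m + k))) WdS.
  rewrite -!mulrA S_ball !dE// -!scalerAr.
  have -> : U * (upow U (2 * (z - 1)) * S ^+ (m + k).+1) = upow U (2 * (z - 1) + 1) * S ^+ (m + k).+1.
    by rewrite mulrA -(upow1 U) -(upowD hQ) addrC.
  by rewrite dE// => <-; rewrite scalerA mulVf// scale1r.
rewrite -!scalerAr [c _ *: (_^-1 *: _)]scalerA divff// scale1r => e.
rewrite addSn e2 (_ : 2 * z - 1 = 2 * (z - 1) + 1); last by ring.
apply: (scalerI (c_neq0 (2 * (z - 1) + 1))); rewrite e !scalerA; congr (_ *: _).
rewrite /jump [in RHS]big_ord_recr/= -/j e2 -/(jump m y) -/j (_ : 2 * z - 1 = 2 * (z - 1) + 1); last by ring.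
by field; exact: c_neq0.
Qed.

Let c_periodic : forall n m, c (n + (2 ^ k)%N%:Z * m) = c n.
Proof. exact: acts_periodic d_acts. Qed.

Let normc_jump m y : Normc.normc (jump m y) = 1.
Proof.
apply: (big_ind (fun z : R[i] => Normc.normc z = 1)) => [|a b ha hb|i _]; first exact: Normc.normc1.
  by rewrite Normc.normcM ha hb mulr1.
by rewrite Normc.normcM Normc.normcV !normc_unimodular// invr1 mulr1.
Qed.

(** [U^#] shifts the ball at $2^m j$ to the one at $2^m j - 1$, and [W] brings it back with the
    factor [jump]. So [jump] is the compression of the fixed element [W * U^#]. *)
Let jump_close e : 0 < e -> exists M, forall m y m' y', (M <= m)%N -> (M <= m')%N ->
  Normc.normc (jump m y - jump m' y') < e.
Proof.
move=> e0; have := @ball_compression_cauchy _ _ S U hQ k k_gt0 (W * U^#) e.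
rewrite hgen => /(_ I e0)[M H]; exists M => m y m' y' mM mM'.
have Hj n z : (ball_isometry S U k n (2 * z + 1))^# * (W * U^#) *
    ball_isometry S U k n (2 * z + 1) = (jump n z)%:A.
  rewrite -!mulrA (_ : U^# * _ = upow U ((2 ^ n)%N%:Z * (2 * z + 1) - 1) * S ^+ (n + k)).
    by rewrite ext_jump -!scalerAr upow_pow_isometry.
  rewrite /ball_isometry mulrA; congr (_ * _).
  by rewrite [_ - 1]addrC (upowD hQ) -(star_upow hQ) upow1.
by apply: (H m y m' y') => //; exact: Hj.
Qed.

(** For [k <= m] the new factor is taken at points congruent to 0 and -1 modulo $2^k$. *)
Let jumpS m y : (k <= m)%N -> jump m.+1 y = jump m y * (c 0 / c (-1)).
Proof.
move=> km; rewrite /jump big_ord_recr/=; congr (_ * (_ / _)).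
  rewrite (_ : _ * _ = 0 + (2 ^ k)%N%:Z * ((2 ^ (m.+1 - k))%N%:Z * (2 * y + 1))).
    exact: c_periodic.
  by rewrite add0r mulrA -PoszM -expnD subnKC// leqW.
rewrite (_ : _ - 1 = -1 + (2 ^ k)%N%:Z * ((2 ^ (m.+1 - k))%N%:Z * (2 * y + 1))).
  exact: c_periodic.
by rewrite mulrA -PoszM -expnD subnKC ?leqW// addrC.
Qed.

(** Consecutive jumps have modulus 1 and quotient [c 0 / c (-1)]; since they become arbitrarily
    close, the quotient is 1. *)
Lemma ext_ends : c (-1) = c 0.
Proof.
suff /subr0_eq e : c 0 / c (-1) - 1 = 0.
  by rewrite -[RHS](divfK (c_neq0 (-1))) e mul1r.
apply: normc_lt_eps => e /jump_close[M H].
have := H (maxn M k).+1 0 (maxn M k) 0; rewrite jumpS ?leq_maxr//.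
rewrite -[X in _ * _ - X]mulr1 -mulrBr Normc.normcM normc_jump mul1r.
by apply; [rewrite leqW// leq_maxl|rewrite leq_maxl].
Qed.

(** From level [k] on the jump is independent of the level, so closeness at high levels is equality
    at level [k]. *)
Lemma jump_const y : jump k y = jump k 0.
Proof.
have jE m z : jump (k + m) z = jump k z.
  elim: m => [|m IH]; first by rewrite addn0.
  by rewrite addnS jumpS ?leq_addr// IH ext_ends divff// mulr1.
apply/eqP; rewrite -subr_eq0; apply/eqP/normc_lt_eps => e /jump_close[M H].
by rewrite -(jE M y) -(jE M 0); apply: H; rewrite leq_addl.
Qed.

End Jump.

(** * Diagonal elements fixed by the automorphism *)

Section DiagonalAutomorphism.
Variables (R : realType) (A : cstarAlgType R) (S U : A).
Hypothesis hQ : Q2_relations S U.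
Local Notation "x ^#" := (star x).

Lemma acts_weaken k l x f : (k <= l)%N -> acts S U k x f -> acts S U l x f.
Proof. by move=> kl hx n m lm; apply: hx; exact: leq_trans lm. Qed.

Lemma acts_prod k N (x : nat -> A) (f : nat -> int -> R[i]) :
  (forall i, acts S U k (x i) (f i)) ->
  acts S U k (\prod_(i < N) x i) (fun n => \prod_(i < N) f i n).
Proof.
move=> hx; elim: N => [|N IH].
  by move=> n l kl; rewrite !big_ord0; exact: (acts1 S U (k := k)).
by move=> n l kl; rewrite !big_ord_recr/=; exact: (actsM IH (hx N)).
Qed.

(** Algebra elements with the values $c(2^i n)$ that occur in [transfer0]. *)
Definition shifted (d : A) (i : nat) : A := iter i (fun x => S^# * x * S) d.

Lemma acts_shifted k d f i : acts S U k d f ->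
  acts S U k (shifted d i) (fun n => f ((2 ^ i)%N%:Z * n)).
Proof.
move=> hd; elim: i => [|i IH] n l kl; first by rewrite expn0 mul1r; exact: hd.
by rewrite expnSr PoszM -mulrA; exact: (acts_compress hQ IH n kl).
Qed.

Lemma O2_shifted d i : O2 S U d -> O2 S U (shifted d i).
Proof.
have H := O2_subalgebra S U; have HS : O2 S U S by exact: O2_S.
by move=> hd; elim: i => [|i IH] //; apply: (csubM3 H) => //; exact: (csub_star H).
Qed.

Variables (k : nat) (d : A) (c : int -> R[i]) (lambda : A -> A).
Hypotheses (d_unitary : unitary d) (d_acts : acts S U k d c).
Hypothesis d_lambda : is_lambda S U d lambda.

(** By induction on the word, the image of the projection is its conjugate by [d], and [d] commutes
    with it because both are diagonal. *)
Lemma lambda_proj (s : seq 'I_2) :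
  let m := \prod_(i <- s) gen S U i in lambda (m * m^#) = m * m^#.
Proof.
have H := O2_subalgebra S U.
have [[[l1 lD lZ lM ls] _] lg] := d_lambda; have [_ dd] := d_unitary.
elim: s => [|i s IH] /=; first by rewrite big_nil star1 mulr1.
have [f hf] := acts_proj hQ (in_tuple (i :: s)).
have hd := acts_weaken (leq_maxl k (size (i :: s))) d_acts.
have := acts_comm hQ hd (acts_weaken (leq_maxr k (size (i :: s))) hf).
rewrite /Defs.proj /monomial /= big_cons.
set m := \prod_(j <- s) _ in IH *; rewrite starM => comm.
have Om : O2 S U (m * m^#) by exact: (O2_proj hQ (in_tuple s)).
have Og : O2 S U (gen S U i) by exact: O2_gen.
have Ogs := csub_star H Og.
have e : gen S U i * m * (m^# * (gen S U i)^#) = gen S U i * (m * m^#) * (gen S U i)^#.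
  by rewrite !mulrA.
rewrite e in comm *; rewrite lM//; last exact: (csubM H).
rewrite lM// ls// lg IH starM.
rewrite [_ * (_ * d^#)]mulrA.
rewrite [d * gen S U i * _ * _](_ : _ = d * (gen S U i * (m * m^#) * (gen S U i)^#)); last by rewrite !mulrA.
by rewrite comm -mulrA dd mulr1.
Qed.

Lemma lambda_D2_level l x : D2_level S U l x -> lambda x = x.
Proof.
have H := O2_subalgebra S U.
have [[[l1 lD lZ lM ls] _] lg] := d_lambda.
move=> [b ->]; suff [] : O2 S U (\sum_i b i *: Defs.proj S U i) /\
    lambda (\sum_i b i *: Defs.proj S U i) = \sum_i b i *: Defs.proj S U i by [].
apply: (big_ind (fun x => O2 S U x /\ lambda x = x)) => [|y z [Oy ly] [Oz lz]|al _].
- by split; [exact: (csub0 H)|rewrite -(scale0r 0) lZ ?scale0r//; exact: (csub0 H)].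
- by split; [exact: (csubD H)|rewrite lD// ly lz].
- have Op : O2 S U (Defs.proj S U al) by exact: O2_proj.
  split; first exact: (csubZ H).
  by rewrite lZ//; have := lambda_proj al; rewrite /Defs.proj /monomial/= => ->.
Qed.

(** The factors [d^#] and [d] coming from the images of [S^#] and [S] enclose a diagonal element, so
    they cancel. *)
Lemma lambda_shifted i : O2 S U d -> lambda d = d ->
  lambda (shifted d i) = shifted d i.
Proof.
have H := O2_subalgebra S U; have OS : O2 S U S by exact: O2_S.
have OSs := csub_star H OS.
have [[[l1 lD lZ lM ls] _] lg] := d_lambda; have [dd _] := d_unitary.
have lS : lambda S = d * S by have := lg (@Ordinal 2 1 isT).
move=> Od ld; elim: i => [|i IH] //=; have Oi := O2_shifted i Od.
rewrite lM//; last exact: (csubM H).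
rewrite lM// ls// lS -/(shifted d i) IH starM.
have comm := acts_comm hQ d_acts (acts_shifted i d_acts).
rewrite -!mulrA [shifted d i * _]mulrA -comm [d^# * _]mulrA [d^# * (_ * _)]mulrA dd mul1r.
by [].
Qed.

End DiagonalAutomorphism.

(** * Conjugation of homomorphisms by a unitary *)

Section Conjugation.
Variables (R : realType) (A : cstarAlgType R).
Local Notation "x ^#" := (star x).

Lemma star_hom_conj_l (X : set A) (f : A -> A) w : unitary w ->
  unital_star_hom X f -> unital_star_hom X (fun x => w * f x * w^#).
Proof.
move=> [w1 w2] [f1 fD fZ fM fs]; split=> [|x y Xx Xy|a x Xx|x y Xx Xy|x Xx].
- by rewrite f1 mulr1.
- by rewrite fD// mulrDr mulrDl.
- by rewrite fZ// -scalerAr -scalerAl.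
- by rewrite fM// -!mulrA [w^# * (w * _)]mulrA w1 mul1r.
- by rewrite fs// !starM starK mulrA.
Qed.

Lemma star_hom_conj_r (X : set A) (f : A -> A) w : unitary w ->
  cstar_subalgebra X -> X w ->
  unital_star_hom X f -> unital_star_hom X (fun x => f (w^# * x * w)).
Proof.
move=> [w1 w2] XA Xw [f1 fD fZ fM fs]; have Xws := csub_star XA Xw.
have Xc x : X x -> X (w^# * x * w) by move=> Xx; exact: (csubM3 XA).
split=> [|x y Xx Xy|a x Xx|x y Xx Xy|x Xx].
- by rewrite mulr1 w1.
- by rewrite mulrDr mulrDl fD//; exact: Xc.
- by rewrite -scalerAr -scalerAl fZ//; exact: Xc.
- rewrite -fM; [|exact: Xc|exact: Xc]; congr f.
  by rewrite -!mulrA [w * (w^# * _)]mulrA w2 mul1r.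
- by rewrite -fs; [rewrite !starM starK mulrA|exact: Xc].
Qed.

Lemma star_auto_conj (X : set A) w : unitary w -> cstar_subalgebra X -> X w ->
  star_auto X (fun x => w * x * w^#).
Proof.
move=> hw XA Xw; have Xws := csub_star XA Xw; have [w1 w2] := hw.
split; first by apply: (star_hom_conj_l (f := id)).
split=> [x Xx|x y _ _ e|y Xy].
- by exact: (csubM3 XA).
- have := congr1 (fun z => w^# * z * w) e.
  by rewrite /= -!mulrA w1 !mulr1 !mulrA w1 !mul1r.
- exists (w^# * y * w); first by exact: (csubM3 XA).
  by rewrite -!mulrA w2 mulr1 mulrA w2 mul1r.
Qed.

End Conjugation.

(** * The gauge factor and the inner factor *)

Theorem theorem5p6 (R : realType) (A : cstarAlgType R) (S2 U : A)
    (HQ2 : is_Q2 S2 U) (k : nat) (hk : (0 < k)%N)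
    (d : A) (hd : unitary d) (hdk : D2_level S2 U k d)
    (lambda_d : A -> A) (hlambda : is_lambda S2 U d lambda_d)
    (hext : extends_to_automorphism S2 U lambda_d) :
  exists (theta : R) (g psi : A -> A),
    [/\ gauge_automorphism S2 U theta g,
        inner_automorphism S2 U psi,
        localized_automorphism S2 U psi
      & forall x, O2 S2 U x -> lambda_d x = g (psi x)].
Proof.
have [hQ hgen _] := HQ2; have H := O2_subalgebra S2 U.
have [c d_acts] := acts_D2_level hQ hdk.
have c_uni := acts_unitary_value hQ d_acts hd.
have c_neq0 n : c n != 0 by exact: unimodular_neq0.
have [Phi [Phi_auto PhiE]] := hext.
have [[P1 PD PZ PM Ps] [_ Pinj _]] := Phi_auto.
have [[[l1 lD lZ lM ls] lO] lg] := hlambda.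
have OS i : O2 S2 U (gen S2 U i) by exact: O2_gen.
have OSS : O2 S2 U S2 by exact: O2_S.
have PS : Phi S2 = d * S2 by rewrite PhiE//; have := lg (@Ordinal 2 1 isT).
have WdS : Phi U * (d * S2) = d * (U * S2).
  rewrite -PS -PM// PhiE; first by have := lg ord0.
  by have := OS ord0.
have WWdS : Phi U * Phi U * (d * S2) = d * S2 * Phi U.
  by rewrite -PS -!PM//; case: hQ => _ _ _ ->; rewrite expr2.
have ends := ext_ends hQ hgen hk d_acts c_uni WdS WWdS.
have jumpc := jump_const hQ hgen hk d_acts c_uni WdS WWdS.
have per := acts_periodic hQ d_acts.
pose t := transfer0 k c.
have t_even : forall y, c (2 * y) * t y = c 0 * t (2 * y).
  exact: transfer0_even c_neq0 per.
have t_odd : forall y, c (2 * y + 1) * t y = c 0 * t (2 * y + 1).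
  exact: transfer0_odd c_neq0 per ends jumpc.
(* An element of $\mathcal{O}_2$ with the values [transfer0]: since [c] has modulus 1, the adjoint
   provides the inverses. *)
pose w : A := \prod_(i < k) (c 0 *: star (shifted S2 d i.+1)).
have w_acts : acts S2 U k w t.
  have -> : t = (fun n => \prod_(i < k) (c 0 * (c ((2 ^ i.+1)%N%:Z * n))^*%C)).
    apply: funext => n; apply: eq_bigr => i _; congr (_ * _).
    by apply: (mulfI (c_neq0 ((2 ^ i.+1)%N%:Z * n))); rewrite c_uni divff.
  have wi_acts i : acts S2 U k (c 0 *: star (shifted S2 d i.+1))
      (fun n => c 0 * (c ((2 ^ i.+1)%N%:Z * n))^*%C).
    exact: (actsZ _ (acts_star (acts_shifted hQ i.+1 d_acts))).
  exact: (acts_prod k wi_acts).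
have t_uni n : t n * (t n)^*%C = 1.
  apply: (big_ind (fun z : R[i] => z * z^*%C = 1)) => [|x y hx hy|i _].
  - by rewrite conjc1 mulr1.
  - by rewrite rmorphM/= mulrACA hx hy mulr1.
  - by rewrite rmorphM/= mulrACA c_uni mul1r conjc_inv -invfM c_uni invr1.
have w_unitary := acts_unitary hQ w_acts t_uni; have [ws_w w_ws] := w_unitary.
have Od : O2 S2 U d by exact: (O2_D2_level hQ hdk).
have ld : lambda_d d = d := lambda_D2_level hQ hd d_acts hlambda hdk.
have [Ow lw] : O2 S2 U w /\ lambda_d w = w.
  apply: (big_ind (fun x => O2 S2 U x /\ lambda_d x = x)) => [|x y [Ox lx] [Oy ly]|i _].
  - by split; [exact: (O2_1 hQ)|].
  - by split; [exact: (csubM H)|rewrite lM// lx ly].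
  - have Oi := O2_shifted i.+1 Od; have Ois := csub_star H Oi.
    split; first exact: (csubZ H).
    by rewrite lZ// ls// (lambda_shifted hQ hd d_acts hlambda).
have Ows := csub_star H Ow.
(* Compared on balls, this is [t_even] when the letter prefixes the digit 0 and [t_odd] when it
   prefixes 1. *)
have cocycle i : d * gen S2 U i * w = c 0 *: (w * gen S2 U i).
  apply: (eq_on_cylinders hQ (k := k)) => n.
  have [e [e01 gE]] := gen_upow hQ i n k.
  have [wE _] := w_acts n k (leqnn k).
  have [dE _] := d_acts (2 * n + e) k.+1 (leqnSn k).
  have [wE' _] := w_acts (2 * n + e) k.+1 (leqnSn k).
  rewrite -!mulrA wE -!scalerAr gE dE -scalerAl -mulrA gE wE' !scalerA; congr (_ *: _).
  by rewrite mulrC; case: e01 => ->; rewrite ?addr0 ?t_even ?t_odd.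
have [theta cE] := unimodular_polar (c_uni 0).
(* With this choice the factorization is immediate and [g] is a homomorphism on $\mathcal{O}_2$;
   what remains is its value on the generators and its bijectivity. *)
pose g x := lambda_d (star w * x * w).
have gE i : g (gen S2 U i) = c 0 *: gen S2 U i.
  rewrite /g lM//; last exact: (csubM H).
  by rewrite lM// ls// lw lg -mulrA cocycle -scalerAr mulrA ws_w mul1r.
exists theta, g, (fun x => w * x * star w); split.
- split; last by move=> i; rewrite -cE gE.
  have Oc x : O2 S2 U x -> O2 S2 U (star w * x * w).
    by move=> Ox; exact: (csubM3 H).
  split; first exact: (star_hom_conj_r w_unitary H Ow hlambda.1.1).
  split=> [x Ox|x y|y Oy].
  + by apply: lO; exact: Oc.
  + rewrite !inE => Ox Oy; rewrite /g -!PhiE; [|exact: Oc|exact: Oc].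
    move=> /Pinj; rewrite !inE => /(_ I I) e.
    have := congr1 (fun z => w * z * star w) e.
    by rewrite /= -!mulrA w_ws !mulr1 !mulrA w_ws !mul1r.
  (* Surjectivity: the preimage of [y] is [w * Psi y * star w], provided it lies in $\mathcal{O}_2$.
     This is checked on generators, where [gE] exhibits the preimage as a multiple of the generator
     itself. *)
  + have [Psi [Psi_hom PhiK PsiK]] := star_auto_inverse Phi_auto.
    have Psi'_hom := star_hom_conj_l w_unitary Psi_hom.
    have sub : O2 S2 U `<=` (fun x => w * Psi x * star w) @^-1` O2 S2 U.
      apply: cstar_generated_min; first exact: preimage_cstar_subalgebra.
      move=> _ [i _ <-] /=.
      have -> : gen S2 U i = Phi (star w * ((c 0)^-1 *: gen S2 U i) * w).
        rewrite -scalerAr -scalerAl PZ// PhiE; last by apply: Oc; exact: OS.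
        by rewrite -/(g _) gE scalerA mulVf// scale1r.
      rewrite PhiK -!mulrA w_ws mulr1 mulrA w_ws mul1r.
      by apply: (csubZ H); exact: OS.
    exists (w * Psi y * star w); first exact: sub.
    rewrite /g -PhiE; last by apply: Oc; exact: sub.
    by rewrite -!mulrA ws_w mulr1 mulrA ws_w mul1r PsiK.
- by exists w; split.
- have psi_auto := star_auto_conj w_unitary H Ow.
  (* [cocycle] reads $w S_i w^* = c(0)^{-1} d S_i$, so conjugation by [w] is $\lambda_u$ for $u =
     c(0)^{-1} d$. *)
  split => //; exists ((c 0)^-1 *: d); split.
  + have [d1 d2] := hd.
    have c1 : ((c 0)^-1)^*%C * (c 0)^-1 = 1.
      by rewrite conjc_inv -invfM mulrC c_uni invr1.
    by split; rewrite starZ -scalerAl -scalerAr scalerA ?d1 ?d2 ?c1 1?mulrC ?c1 scale1r.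
  + exists k; have [b dE] := hdk.
    (* $\mathcal{D}_2^k$ is the diagonal part of $\mathcal{F}_2^k$: the off-diagonal coefficients
       vanish. *)
    exists (fun ab => if ab.1 == ab.2 then (c 0)^-1 * b ab.1 else 0).
    rewrite -(pair_bigA _ (fun x y => (if x == y then (c 0)^-1 * b x else 0) *:
      (monomial S2 U x * star (monomial S2 U y))))/=.
    rewrite dE scaler_sumr; apply: eq_bigr => x _.
    rewrite (bigD1 x)//= eqxx big1 ?addr0 ?scalerA// => y yx.
    by rewrite eq_sym (negbTE yx) scale0r.
  + split; first by split; [exact: psi_auto.1|by have [_ []] := psi_auto].
    move=> i; rewrite -scalerAl -[d * _]mulr1 -w_ws [d * _ * _]mulrA cocycle.
    by rewrite -scalerAl scalerA mulVf// scale1r.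
- by move=> x Ox; rewrite /g -!mulrA ws_w mulr1 mulrA ws_w mul1r.
Qed.
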